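(* A graph $G$ is a connected quasi-threshold graph with exactly two main $\mathbf{Q}$-eigenvalues if and only if $G$ has one of the following forms: (a) $G = K_c\oplus(K_a\cup K_b)$ for integers $a,b,c\geq 1$ with $a\neq b$; (b) $G = K_c\oplus(tK_a)$ for integers $t\geq 2$ and $a,c\geq 1$.
   Context: All graphs are finite and simple. A quasi-threshold graph is a graph with no induced $C_4$ and no induced $P_4$. $K_n$ is the complete graph on $n$ vertices, $\cup$ denotes disjoint union, $tK_a$ is the disjoint union of $t$ copies of $K_a$, and $\oplus$ denotes the join (disjoint union plus all edges between the two vertex sets). $\mathbf{Q}(G)=\mathbf{D}(G)+\mathbf{A}(G)$ is the signless Laplacian matrix; an eigenvalue of $\mathbf{Q}(G)$ is main if its eigenspace is not orthogonal to the all-ones vector, and the number of main $\mathbf{Q}$-eigenvalues counts distinct such eigenvalues. *)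

(* Defs.v *)
From mathcomp Require Import all_boot all_order all_algebra.

Set Implicit Arguments.
Unset Strict Implicit.
Unset Printing Implicit Defensive.

Import GRing.Theory Num.Theory.
Local Open Scope ring_scope.

Record sgraph := SGraph {
  vertex :> finType;
  edge : rel vertex;
  edge_sym : symmetric edge;
  edge_irrefl : irreflexive edge }.

Definition isomorphic (G H : sgraph) : Prop :=
  exists2 f : G -> H, bijective f & forall x y, edge (f x) (f y) = edge x y.

Definition has_induced (H G : sgraph) : Prop :=
  exists2 f : H -> G, injective f & forall x y, edge (f x) (f y) = edge x y.

Definition is_connected (G : sgraph) : Prop :=
  (0 < #|G|)%N /\ forall x y : G, connect (@edge G) x y.

Section StandardGraphs.
Variable n : nat.

Definition complete_edge : rel 'I_n := fun i j => i != j.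

Fact complete_edge_sym : symmetric complete_edge.
Proof. by move=> i j; rewrite /complete_edge eq_sym. Qed.

Fact complete_edge_irrefl : irreflexive complete_edge.
Proof. by move=> i; rewrite /complete_edge eqxx. Qed.

Definition complete := SGraph complete_edge_sym complete_edge_irrefl.

Definition path_edge : rel 'I_n :=
  fun i j => (i.+1 == j :> nat) || (j.+1 == i :> nat).

Fact path_edge_sym : symmetric path_edge.
Proof. by move=> i j; rewrite /path_edge orbC. Qed.

Fact path_edge_irrefl : irreflexive path_edge.
Proof. by move=> i; rewrite /path_edge orbb gtn_eqF. Qed.

Definition path_graph := SGraph path_edge_sym path_edge_irrefl.

(* [ordS] is the cyclic successor; [i != j] only matters when n = 1. *)
Definition cycle_edge : rel 'I_n :=
  fun i j => (i != j) && ((ordS i == j) || (ordS j == i)).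

Fact cycle_edge_sym : symmetric cycle_edge.
Proof. by move=> i j; rewrite /cycle_edge eq_sym orbC. Qed.

Fact cycle_edge_irrefl : irreflexive cycle_edge.
Proof. by move=> i; rewrite /cycle_edge eqxx. Qed.

Definition cycle_graph := SGraph cycle_edge_sym cycle_edge_irrefl.

End StandardGraphs.

Section Operations.
Variables G H : sgraph.

Definition union_edge : rel (G + H)%type := fun x y =>
  match x, y with
  | inl u, inl v => edge u v
  | inr u, inr v => edge u v
  | _, _ => false
  end.

Fact union_edge_sym : symmetric union_edge.
Proof. by case=> u [] v //=; rewrite edge_sym. Qed.

Fact union_edge_irrefl : irreflexive union_edge.
Proof. by case=> u /=; rewrite edge_irrefl. Qed.

Definition disjoint_union := SGraph union_edge_sym union_edge_irrefl.

Definition join_edge : rel (G + H)%type := fun x y =>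
  match x, y with
  | inl u, inl v => edge u v
  | inr u, inr v => edge u v
  | _, _ => true
  end.

Fact join_edge_sym : symmetric join_edge.
Proof. by case=> u [] v //=; rewrite edge_sym. Qed.

Fact join_edge_irrefl : irreflexive join_edge.
Proof. by case=> u /=; rewrite edge_irrefl. Qed.

Definition graph_join := SGraph join_edge_sym join_edge_irrefl.

End Operations.

Section Copies.
Variables (t : nat) (G : sgraph).

Definition copies_edge : rel ('I_t * G)%type :=
  fun x y => (x.1 == y.1) && edge x.2 y.2.

Fact copies_edge_sym : symmetric copies_edge.
Proof. by move=> x y; rewrite /copies_edge eq_sym edge_sym. Qed.

Fact copies_edge_irrefl : irreflexive copies_edge.
Proof. by move=> x; rewrite /copies_edge edge_irrefl andbF. Qed.

Definition copies := SGraph copies_edge_sym copies_edge_irrefl.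

End Copies.

Definition quasi_threshold (G : sgraph) : Prop :=
  ~ has_induced (cycle_graph 4) G /\ ~ has_induced (path_graph 4) G.

Section SignlessLaplacian.
Variables (R : rcfType) (G : sgraph).

Definition degree (x : G) : nat := #|[set y | edge x y]|.

Definition adjacency_mx : 'M[R]_#|G| :=
  \matrix_(i, j) (edge (enum_val i) (enum_val j))%:R.

Definition degree_mx : 'M[R]_#|G| :=
  diag_mx (\row_i (degree (enum_val i))%:R).

Definition signless_laplacian : 'M[R]_#|G| := degree_mx + adjacency_mx.

(* The row space of [eigenspace A a] is the space of the v with v *m A = a *: v;
   as the signless Laplacian is symmetric, these are the transposes of its
   usual (column) eigenvectors. *)
Definition main_eigenvalue (a : R) : Prop :=
  eigenvalue signless_laplacian a /\
  exists2 v : 'rV[R]_#|G|,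
    (v <= eigenspace signless_laplacian a)%MS & \sum_i v 0 i != 0.

Definition num_main_eigenvalues (k : nat) : Prop :=
  exists s : seq R,
    [/\ uniq s, size s = k & forall a, a \in s <-> main_eigenvalue a].

End SignlessLaplacian.

(* Main.v *)
(* The number of main eigenvalues is two exactly when 1 is not an eigenvector
   of Q and Q^2 1 is a combination of Q 1 and 1; as Q 1 = 2 d, this says that G
   is not regular and that d(x)^2 + sum_{y ~ x} d(y) = p d(x) + q for all x.
   In a quasi-threshold graph the closed neighbourhoods of adjacent vertices are
   nested, so a connected one has a universal vertex u. Subtracting the equation
   at x from that at u shows that, for some constant K, the mean of d over the
   complement of N[x] equals K - d(x) for every nonuniversal x. Let t have the
   largest degree among the nonuniversal vertices and y the smallest degree
   outside N[t]. The means outside N[t] and N[y] give d(y) <= K - d(t) and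
   K - d(y) <= d(t), so both are equalities: all vertices outside N[t] have degree
   d(y) and all vertices outside N[y] have degree d(t). By nestedness the
   nonuniversal vertices then form disjoint cliques, which are all of the same
   size if d(t) = d(y), and are just N[t] and N[y] minus the universal vertices
   otherwise. *)

Require Import Defs.
From mathcomp Require Import all_boot all_order all_algebra spectral complex.
From mathcomp Require Import ring lra zify.

Set Implicit Arguments.
Unset Strict Implicit.
Unset Printing Implicit Defensive.

Import Order.TTheory GRing.Theory Num.Theory.

(** * Symmetric real matrices with exactly two eigenvalues that are main for a given vector *)

Section SymmetricMatrices.
Local Open Scope ring_scope.
Variables (R : rcfType) (n : nat).
Implicit Types (A : 'M[R]_n) (u v e : 'rV[R]_n).

Definition dot u v : R := (u *m v^T) 0 0.

Lemma dotE u v : dot u v = \sum_i u 0 i * v 0 i.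
Proof. by rewrite /dot mxE; apply: eq_bigr => i _; rewrite mxE. Qed.

Lemma dotC u v : dot u v = dot v u.
Proof. by rewrite !dotE; apply: eq_bigr => i _; rewrite mulrC. Qed.

Lemma dotDl u1 u2 v : dot (u1 + u2) v = dot u1 v + dot u2 v.
Proof. by rewrite /dot mulmxDl mxE. Qed.

Lemma dotZl a u v : dot (a *: u) v = a * dot u v.
Proof. by rewrite /dot -scalemxAl mxE. Qed.

Lemma dot_sym A u v : A^T = A -> dot (u *m A) v = dot u (v *m A).
Proof. by move=> sA; rewrite /dot trmx_mul sA mulmxA. Qed.

Lemma dot_ge0 u : 0 <= dot u u.
Proof. by rewrite dotE sumr_ge0 // => i _; rewrite -expr2 sqr_ge0. Qed.

Lemma dot_eq0 u : (dot u u == 0) = (u == 0).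
Proof.
apply/idP/eqP => [|->]; last by rewrite /dot mul0mx mxE.
rewrite dotE psumr_eq0 => [/allP u0|i _]; last by rewrite -expr2 sqr_ge0.
apply/rowP => i; rewrite mxE; apply/eqP.
by have := u0 i (mem_index_enum _); rewrite -expr2 sqrf_eq0.
Qed.

(* Over R[i] the rows of the unitary diagonalizing matrix are eigenvectors for
   real eigenvalues, so their real and imaginary parts are eigenvectors over R. *)
Lemma orthogonal_eigenvectors_eq0 A u : A^T = A ->
  (forall a v, v *m A = a *: v -> dot u v = 0) -> u = 0.
Proof.
move=> sA uA.
pose AC : 'M[R[i]]_n := map_mx (real_complex R) A.
have hAC : AC \is hermsymmx.
  apply/is_hermitianmxP; rewrite expr0 scale1r; apply/matrixP => i j.
  by rewrite !mxE -[A in RHS]sA mxE /= conj_Creal // complex_real eqxx.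
have /orthomx_spectralP AE := hermitian_normalmx hAC.
have dR := hermitian_spectral_diag_real hAC.
set P := spectralmx AC in AE; set d := spectral_diag AC in AE dR.
have uP : P \in unitmx by apply: spectral_unit.
have PA : P *m AC = diag_mx d *m P.
  by rewrite AE !mulmxA mulmxV // mul1mx.
pose uC : 'rV[R[i]]_n := map_mx (real_complex R) u.
suff : P *m uC^T = 0.
  move=> /(congr1 (mulmx (invmx P))); rewrite mulmxA mulVmx // mul1mx mulmx0.
  move=> /matrixP u0; apply/rowP => i; have := u0 i 0.
  by rewrite !mxE => -[].
apply/colP => i; rewrite [RHS]mxE.
have Pij j : \sum_k P i k * (A k j)%:C%C = d 0 i * P i j.
  have /matrixP/(_ i j) := PA; rewrite mul_diag_mx !mxE => <-.
  by apply: eq_bigr => k _; rewrite mxE.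
have dE : d 0 i = (complex.Re (d 0 i))%:C%C.
  by apply/esym/RRe_real; move/mxOverP: dR; apply.
have reP : \sum_k complex.Re (P i k) * u 0 k = 0.
  rewrite -[RHS](uA (complex.Re (d 0 i)) (\row_k complex.Re (P i k))).
    by rewrite dotE; apply: eq_bigr => k _; rewrite mxE mulrC.
  apply/rowP => j; rewrite !mxE.
  have := congr1 (@complex.Re R) (Pij j).
  rewrite dE raddf_sum /=; case: (P i j) => x y /=; rewrite mul0r subr0 => <-.
  apply: eq_bigr => k _; rewrite mxE; case: (P i k) => x' y' /=.
  by rewrite mulr0 subr0.
have imP : \sum_k complex.Im (P i k) * u 0 k = 0.
  rewrite -[RHS](uA (complex.Re (d 0 i)) (\row_k complex.Im (P i k))).
    by rewrite dotE; apply: eq_bigr => k _; rewrite mxE mulrC.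
  apply/rowP => j; rewrite !mxE.
  have := congr1 (@complex.Im R) (Pij j).
  rewrite dE raddf_sum /=; case: (P i j) => x y /=; rewrite mul0r addr0 => <-.
  apply: eq_bigr => k _; rewrite mxE; case: (P i k) => x' y' /=.
  by rewrite mulr0 add0r.
rewrite mxE; apply/eqP; rewrite eq_complex !raddf_sum /=.
apply/andP; split; apply/eqP.
  rewrite -[RHS]reP; apply: eq_bigr => k _; rewrite !mxE.
  by case: (P i k) => x y /=; rewrite mulr0 subr0.
rewrite -[RHS]imP; apply: eq_bigr => k _; rewrite !mxE.
by case: (P i k) => x y /=; rewrite mulr0 add0r.
Qed.

(** [a] and [b] are the roots of X^2 - p X - q, distinct because the discriminant is positive. *)
Lemma real_factorization (p q : R) : 0 < p ^+ 2 + 4 * q ->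
  exists a b, [/\ a != b, p = a + b & q = - (a * b)].
Proof.
move=> disc_gt0; pose t := Num.sqrt (p ^+ 2 + 4 * q).
have t_gt0 : 0 < t by rewrite sqrtr_gt0.
have tt : t ^+ 2 = p ^+ 2 + 4 * q by rewrite sqr_sqrtr // ltW.
exists ((p + t) / 2), ((p - t) / 2); split; last 2 first.
- by field.
- have -> : q = (t ^+ 2 - p ^+ 2) / 4 by rewrite tt; field.
  by field.
by apply/eqP => ?; lra.
Qed.

(** [e] stands in for the all-ones vector; [dot v e != 0] already makes [v] nonzero, hence an
    eigenvector. *)
Definition main_for A e a := exists2 v, v *m A = a *: v & dot v e != 0.

(** Main eigenvalues belong to the nonzero components of [e] in the eigenspaces. There are two of
    them iff [e] is not an eigenvector but is killed by a quadratic polynomial in [A]. *)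
Lemma two_main_for A e : A^T = A ->
  (exists s : seq R,
     [/\ uniq s, size s = 2 & forall a, a \in s <-> main_for A e a]) <->
  (forall a, e *m A <> a *: e) /\
  exists p q, e *m A *m A = p *: (e *m A) + q *: e.
Proof.
move=> sA; split.
  case=> s []; case: s => [|a [|b [|//]]] //=; rewrite inE andbT => ab _ main.
  have /main[va vaA va0] : a \in [:: a; b] by rewrite inE eqxx.
  have /main[vb vbA vb0] : b \in [:: a; b] by rewrite !inE eqxx orbT.
  split=> [c ec|].
    (* Symmetry gives l <v,e> = <vA,e> = <v,eA> = c <v,e>, so [c] would be the only main
       eigenvalue. *)
    have cE l v : v *m A = l *: v -> dot v e != 0 -> l = c.
      move=> vA ve; apply: (mulIf ve).
      by rewrite -dotZl -vA dot_sym // ec dotC dotZl dotC.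
    by rewrite (cE _ _ vaA va0) (cE _ _ vbA vb0) eqxx in ab.
  (* These are the coefficients of (X - a)(X - b). Pairing e (A - a)(A - b) with an eigenvector [v]
     for [l] gives (l - a)(l - b) <e,v>, and either <e,v> = 0 or [l] is [a] or [b]. *)
  exists (a + b), (- (a * b)); apply/eqP; rewrite -subr_eq0; apply/eqP.
  apply: (orthogonal_eigenvectors_eq0 sA) => l v vA.
  have lE : dot (e *m A) v = l * dot e v by rewrite dot_sym // vA dotC dotZl dotC.
  have llE : dot (e *m A *m A) v = l * (l * dot e v).
    by rewrite dot_sym // vA dotC dotZl dotC lE.
  rewrite -scaleN1r !(dotDl, dotZl) llE lE.
  have [->|ve] := eqVneq (dot e v) 0; first by ring.
  have : l \in [:: a; b] by apply/main; exists v; rewrite // dotC.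
  by rewrite !inE => /orP[]/eqP->; ring.
case=> nev [p [q eAA]].
(* This is e (A - r). Once the quadratic is factored with roots [a] and [b], [w b] is an eigenvector
   for [a] and [w a] is one for [b]. *)
pose w r := e *m A - r *: e.
have w0 r : w r != 0.
  by apply/eqP => /eqP; rewrite subr_eq0 => /eqP; apply: nev.
(* Positivity of the discriminant: (A - p/2)^2 e = (p^2/4 + q) e. *)
have disc_gt0 : 0 < p ^+ 2 + 4 * q.
  have : 0 < dot (w (p / 2)) (w (p / 2)) by rewrite lt0r dot_eq0 w0 dot_ge0.
  have : 0 < dot e e.
    rewrite lt0r dot_ge0 andbT dot_eq0; apply/eqP => e0.
    by apply: (nev 0); rewrite e0 mul0mx scaler0.
  have -> : dot (w (p / 2)) (w (p / 2)) = (p ^+ 2 / 4 + q) * dot e e.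
    have /(congr1 (fun u => dot u e)) := eAA.
    rewrite dotDl !dotZl dot_sym // => eAAe.
    rewrite /w -!scaleN1r !dotDl !dotZl.
    rewrite (dotC (e *m A) (_ + _)) (dotC e (_ + _)) !dotDl !dotZl.
    by rewrite eAAe (dotC e (e *m A)); field.
  by move=> e0; rewrite pmulr_lgt0 // => ?; lra.
have [a [b [ab pE qE]]] := real_factorization disc_gt0.
have wA r r' : r + r' = p -> r * r' = - q -> w r' *m A = r *: w r'.
  move=> rp rq; rewrite /w mulmxBl -scalemxAl eAA -rp -[q]opprK -rq.
  by rewrite scalerBr scalerA scalerDl scaleNr addrAC addrK.
(* By symmetry <w r', w r'> = (r - r') <w r', e>; the left side is nonzero, so [w r'] is not
   orthogonal to [e]. *)
have main_w r r' : r != r' -> r + r' = p -> r * r' = - q -> main_for A e r.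
  move=> rr rp rq; exists (w r'); first exact: wA.
  have ww : dot (w r') (w r') = (r - r') * dot (w r') e.
    rewrite {1}/w -scaleNr dotDl dotZl dot_sym // (wA r) // !(dotC e) dotZl.
    by ring.
  have : dot (w r') (w r') != 0 by rewrite dot_eq0.
  by rewrite ww mulf_eq0 negb_or => /andP[].
exists [:: a; b]; split => //=; first by rewrite inE ab.
move=> l; split.
  rewrite !inE => /orP[]/eqP->.
    by apply: (main_w _ b); rewrite // ?qE ?opprK.
  by apply: (main_w _ a); rewrite 1?eq_sym // ?qE ?opprK 1?addrC 1?mulrC.
case=> v vA ve; rewrite !inE.
(* Pairing the quadratic relation with [v] yields (l - a)(l - b) <v,e> = 0. *)
have := congr1 (fun u => dot u v) eAA.
rewrite dotDl !dotZl !dot_sym // vA.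
rewrite -scalemxAl vA !(dotC e) !dotZl => /eqP.
rewrite -subr_eq0.
have -> : l * (l * dot v e) - (p * (l * dot v e) + q * dot v e) =
          (l - a) * (l - b) * dot v e by rewrite pE qE; ring.
by rewrite !mulf_eq0 (negPf ve) orbF !subr_eq0.
Qed.

End SymmetricMatrices.

(** * Main eigenvalues of the signless Laplacian in terms of degrees *)

Section MainEigenvalues.
Local Open Scope ring_scope.
Variables (R : rcfType) (G : sgraph).
Implicit Types f g : G -> R.

Definition vertex_row f : 'rV[R]_#|G| := \row_i f (enum_val i).

Lemma eq_vertex_row f g : vertex_row f = vertex_row g <-> f =1 g.
Proof.
split=> [/rowP fg x|fg]; last by apply/rowP => i; rewrite !mxE fg.
by have := fg (enum_rank x); rewrite !mxE enum_rankK.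
Qed.

Lemma vertex_row_lin a b f g :
  a *: vertex_row f + b *: vertex_row g =
  vertex_row (fun x => a * f x + b * g x).
Proof. by apply/rowP => i; rewrite !mxE. Qed.

Lemma vertex_row_signless f :
  vertex_row f *m signless_laplacian R G =
  vertex_row (fun x => (degree x)%:R * f x + \sum_(y | edge x y) f y).
Proof.
apply/rowP => i; rewrite mulmxDr !mxE; congr (_ + _).
  rewrite (bigD1 i) //= big1 => [|k /negPf ki].
    by rewrite !mxE eqxx mulr1n addr0 mulrC.
  by rewrite !mxE ki mulr0n mulr0.
rewrite [RHS]big_mkcond [RHS]big_enum_val /=.
apply: eq_bigr => k _; rewrite !mxE edge_sym.
by case: edge; rewrite ?mulr1 ?mulr0.
Qed.

Lemma signless_laplacian_sym : (signless_laplacian R G)^T = signless_laplacian R G.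
Proof.
apply/matrixP => i j; rewrite !mxE edge_sym; congr (_ + _).
by rewrite eq_sym; case: eqVneq => [->|].
Qed.

Definition regular := exists k, forall x : G, degree x = k.

Definition affine_degree_sums := exists p q : R, forall x : G,
  (degree x)%:R ^+ 2 + \sum_(y | edge x y) (degree y)%:R = p * (degree x)%:R + q.

(** With [e] the all-ones row, e Q = 2 d, so both sides of the quadratic relation carry a factor 2
    except the constant term: [p] is kept and [q] is halved. *)
Lemma two_main_eigenvalues :
  num_main_eigenvalues R G 2 <-> ~ regular /\ affine_degree_sums.
Proof.
pose e := vertex_row (fun=> 1).
have mainE a : main_eigenvalue G a <-> main_for (signless_laplacian R G) e a.
  have sum_e v : dot v e = \sum_i v 0 i.
    by rewrite dotE; apply: eq_bigr => i _; rewrite mxE mulr1.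
  split=> [[_ [v /eigenspaceP va v0]]|[v va v0]]; first by exists v; rewrite ?sum_e.
  split; last by exists v; [apply/eigenspaceP | rewrite -sum_e].
  apply/eigenvalueP; exists v => //; apply: contraNneq v0 => ->.
  by rewrite /dot mul0mx mxE.
have eQ : e *m signless_laplacian R G = vertex_row (fun x => 2 * (degree x)%:R).
  rewrite vertex_row_signless; apply/eq_vertex_row => x.
  by rewrite sumr_const /degree cardsE; ring.
have -> : num_main_eigenvalues R G 2 <->
    (exists s : seq R, [/\ uniq s, size s = 2 &
      forall a, a \in s <-> main_for (signless_laplacian R G) e a]).
  split=> -[s [us ss sP]]; exists s; split=> // a; rewrite sP; first exact: mainE.
  by apply: iff_sym; apply: mainE.
rewrite (two_main_for e signless_laplacian_sym) eQ.
have lin1 a : a *: e = vertex_row (fun=> a).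
  by apply/rowP => i; rewrite !mxE mulr1.
split=> -[nreg [p [q pq]]]; split.
- case=> k dk; apply: (nreg (2 * k%:R)); rewrite lin1; apply/eq_vertex_row => x.
  by rewrite dk.
- exists p, (q / 2) => x; move: pq; rewrite vertex_row_signless vertex_row_lin.
  move=> /eq_vertex_row/(_ x); rewrite -mulr_sumr => E.
  have : 2 * ((degree x)%:R ^+ 2 + \sum_(y | edge x y) (degree y)%:R) =
         2 * (p * (degree x)%:R + q / 2) :> R by lra.
  by apply: mulfI; rewrite pnatr_eq0.
- move=> a; rewrite lin1 => /eq_vertex_row da; apply: nreg.
  have [x _|G0] := pickP (@predT G); last first.
    by exists 0%N => x; have := G0 x.
  exists (degree x) => y; have := da x; rewrite -(da y) => E.
  have /eqP : (degree x)%:R = (degree y)%:R :> R by lra.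
  by rewrite eqr_nat => /eqP.
- exists p, (2 * q); rewrite vertex_row_signless vertex_row_lin.
  apply/eq_vertex_row => x; rewrite -mulr_sumr; have := pq x => E; lra.
Qed.

End MainEigenvalues.

(** * Nested closed neighbourhoods, universal vertices and the extremal pair *)

Section ClosedNeighbourhoods.
Variable G : sgraph.
Implicit Types x y z u v : G.

Definition cnbr x : {set G} := [set y | (y == x) || edge x y].

Definition universal x := cnbr x == [set: G].

Lemma in_cnbr x y : (y \in cnbr x) = (y == x) || edge x y.
Proof. by rewrite inE. Qed.

Lemma cnbr_refl x : x \in cnbr x.
Proof. by rewrite in_cnbr eqxx. Qed.

Lemma cnbr_sym x y : (y \in cnbr x) = (x \in cnbr y).
Proof. by rewrite !in_cnbr eq_sym edge_sym. Qed.

Lemma edge_cnbr x y : edge x y = (x != y) && (y \in cnbr x).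
Proof. by rewrite in_cnbr eq_sym; case: eqVneq => [->|]; rewrite ?edge_irrefl. Qed.

Lemma card_cnbr x : #|cnbr x| = (degree x).+1.
Proof.
have -> : cnbr x = x |: [set y | edge x y].
  by apply/setP => y; rewrite in_cnbr !inE.
by rewrite cardsU1 inE edge_irrefl.
Qed.

Lemma universalP x : reflect (forall y, y \in cnbr x) (universal x).
Proof.
apply: (iffP eqP) => [-> y|xG]; first by rewrite inE.
by apply/setP => y; rewrite xG inE.
Qed.

Lemma universal_cnbr x y : universal x -> x \in cnbr y.
Proof. by move=> /universalP xG; rewrite cnbr_sym. Qed.

Definition nested := forall x y,
  y \in cnbr x -> degree y <= degree x -> cnbr y \subset cnbr x.

(** If z lies in N[y] but not in N[x], counting gives w in N[x] but not in N[y]; then w, x, y, z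
    induce a C_4 or a P_4, according to whether w and z are adjacent. *)
Lemma quasi_threshold_nested : quasi_threshold G -> nested.
Proof.
case=> noC4 noP4 x y; rewrite in_cnbr => /orP[/eqP-> //|xy] dyx.
apply/negPn/negP => /subsetPn[z zy zx].
have /subsetPn[w wx wy] : ~~ (cnbr x \subset cnbr y).
  apply: contra zx => xy'; have/eqP -> // : cnbr x == cnbr y.
  by rewrite eqEcard xy' !card_cnbr ltnS.
move: zy zx wx wy; rewrite !in_cnbr !negb_or.
have [->|zy /= yz /andP[zx nxz]] := eqVneq z y.
  by rewrite xy andbF.
have [->|wx /= xw /andP[wy nyw]] := eqVneq w x.
  by rewrite (edge_sym y) xy andbF.
have xney : x != y by apply: contraTneq xy => ->; rewrite edge_irrefl.
have wz : w != z by apply: contraTneq xw => ->.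
pose f (i : 'I_4) := nth x [:: w; x; y; z] i.
have f_inj : injective f.
  have U : uniq [:: w; x; y; z] by rewrite /= !inE !negb_or wx wy wz xney (eq_sym x) zx (eq_sym y) zy.
  by move=> i j /eqP; rewrite nth_uniq // => /eqP /val_inj.
have eE := (edge_irrefl, xy, yz, xw, negPf nxz, negPf nyw).
have [wze|wze] := boolP (edge w z); [apply: noC4 | apply: noP4]; exists f => //.
  case=> [[|[|[|[|//]]]] Hi] [[|[|[|[|//]]]] Hj];
  by rewrite /f /= ?eE // edge_sym ?eE ?wze.
case=> [[|[|[|[|//]]]] Hi] [[|[|[|[|//]]]] Hj];
by rewrite /f /= ?eE // ?(negPf wze) // edge_sym ?eE ?(negPf wze).
Qed.

(** For [u] of maximum degree, nestedness makes N[u] closed under adjacency, so by connectedness it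
    contains every vertex. *)
Lemma universal_exists : is_connected G -> nested -> exists u, universal u.
Proof.
case=> /card_gt0P[x0 _] conn nest.
case: (@arg_maxnP _ x0 predT (@degree G)) => // u _ umax.
exists u; apply/universalP => x.
have clo : closed (@edge G) (cnbr u).
  apply: intro_closed; first exact/sym_connect_sym/edge_sym.
  move=> y z yz yu; apply: (subsetP (nest u y yu _)); first exact: umax.
  by rewrite in_cnbr yz orbT.
by rewrite -(closed_connect clo (conn u x)) cnbr_refl.
Qed.

Lemma extremal_pair (R : rcfType) : nested -> (exists u, universal u) ->
  ~ regular G -> affine_degree_sums R G ->
  exists t y, [/\ ~~ universal t, y \notin cnbr t,
    forall x, ~~ universal x -> degree x <= degree t,
    forall x, x \notin cnbr t -> degree x = degree y &
    forall x, x \notin cnbr y -> degree x = degree t].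
Proof.
Local Open Scope ring_scope.
move=> nest [u uU] nreg [p [q pq]].
have du x : universal x -> (degree x).+1 = #|G|.
  by move=> /eqP xG; rewrite -card_cnbr xG cardsT.
(* The statement on means is kept as an equality of sums, which is trivial for universal [v].
   Subtracting the equations at [u] and [v] leaves (d(u) - d(v)) (p + 1 - d(u) - d(v)), whose first
   factor is the size of the complement of N[v]. *)
have [K KP] : exists K : R, forall v,
    \sum_(w | w \notin cnbr v) (degree w)%:R =
    \sum_(w | w \notin cnbr v) (K - (degree v)%:R).
  exists (p + 1 - (degree u)%:R) => v.
  have sumE x : \sum_(w in cnbr x) (degree w)%:R =
      (p + 1) * (degree x)%:R + q - (degree x)%:R ^+ 2 :> R.
    rewrite (bigD1 x) ?cnbr_refl //= (eq_bigl (edge x)) => [|w].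
      have := pq x; lra.
    by rewrite in_cnbr; case: eqVneq => [->|]; rewrite ?edge_irrefl ?andbT.
  have sumG : \sum_(w : G) (degree w)%:R = \sum_(w in cnbr u) (degree w)%:R :> R.
    by apply: eq_bigl => w; rewrite (universalP _ uU).
  have card_non : #|[pred w | w \notin cnbr v]|%:R =
      (degree u)%:R - (degree v)%:R :> R.
    have <- : (degree v + #|[pred w | w \notin cnbr v]|)%N = degree u.
      by apply: succn_inj; rewrite du // -addSn -card_cnbr; apply: cardC.
    by rewrite natrD; ring.
  move: sumG; rewrite (bigID (mem (cnbr v))) /= !sumE => sumG.
  rewrite sumr_const -[_ *+ _]mulr_natl card_non.
  by rewrite -[LHS](addKr (\sum_(i in cnbr v) (degree i)%:R)) sumE sumG; ring.
have [t0 t0U|allU] := pickP [pred x | ~~ universal x]; last first.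
  case: nreg; exists (degree u) => x; apply/eqP.
  by rewrite -eqSS !du //; have /negbFE := allU x.
case: (@arg_maxnP _ t0 [pred x | ~~ universal x] (@degree G)) => //= t tU tmax.
have [y0 y0t] : exists y0, y0 \notin cnbr t.
  by move: tU; rewrite /universal -subTset => /subsetPn[y0 _]; exists y0.
case: (@arg_minnP _ y0 [pred y | y \notin cnbr t] (@degree G)) => //= y yt ymin.
have nonU x z : z \notin cnbr x -> ~~ universal z.
  by apply: contra => /universal_cnbr.
(* The mean degree outside N[t] is K - d(t), at least the minimum d(y); likewise [le2] bounds the
   mean K - d(y) outside N[y] by d(t). *)
have le1 : 0 <= K - (degree t)%:R - (degree y)%:R.
  have : 0 <= \sum_(w | w \notin cnbr t) (K - (degree t)%:R - (degree y)%:R).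
    by rewrite sumrB -KP -sumrB sumr_ge0 // => w wt; rewrite subr_ge0 ler_nat ymin.
  rewrite sumr_const pmulrn_lge0 //.
  by apply/card_gt0P; exists y.
have le2 : K - (degree t)%:R - (degree y)%:R <= 0.
  have : 0 <= \sum_(w | w \notin cnbr y) ((degree t)%:R - (K - (degree y)%:R)).
    rewrite sumrB -KP -sumrB sumr_ge0 // => w wy.
    by rewrite subr_ge0 ler_nat tmax // (nonU y).
  rewrite sumr_const pmulrn_lge0; first by move=> ?; lra.
  by apply/card_gt0P; exists t; rewrite unfold_in /= cnbr_sym.
(* Now K = d(t) + d(y), so the deviations from d(y) outside N[t], and from d(t) outside N[y], have
   constant sign and sum to zero. *)
exists t, y; split=> // x xN; apply/eqP; rewrite -(eqr_nat R) -subr_eq0.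
  have /psumr_eq0P : \sum_(w | w \notin cnbr t) ((degree w)%:R - (degree y)%:R) = 0 :> R.
    rewrite sumrB KP -sumrB big1 // => w _; lra.
  by move->; rewrite // => w wt; rewrite subr_ge0 ler_nat ymin.
have /psumr_eq0P : \sum_(w | w \notin cnbr y) ((degree t)%:R - (degree w)%:R) = 0 :> R.
  rewrite sumrB KP -sumrB big1 // => w _; lra.
move=> sum0; rewrite -oppr_eq0 opprB sum0 // => w wy.
by rewrite subr_ge0 ler_nat tmax // (nonU y).
Qed.

End ClosedNeighbourhoods.

(** * Recognizing the two join forms *)

Lemma embedding_isomorphic (G H : sgraph) (f : H -> G) :
  injective f -> (forall x y, edge (f x) (f y) = edge x y) -> #|G| <= #|H| ->
  isomorphic G H.
Proof.
(* The cardinality bound makes the injection bijective, so the later constructions need only a count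
   instead of an explicit inverse. *)
move=> finj fE card_le; have [g fK gK] := inj_card_bij finj card_le.
by exists g => [|x y]; [exists f | rewrite -fE !gK].
Qed.

Section JoinDecomposition.
Variable G : sgraph.

Definition universals := [set x : G | universal x].

(** When adjacent nonuniversal vertices share their closed neighbourhood, the blocks of nonuniversal
    vertices are the disjoint cliques left after deleting the universal vertices. *)
Definition block (x : G) := cnbr x :\: universals.

Lemma card_block (x : G) : #|block x| = (degree x).+1 - #|universals|.
Proof.
rewrite cardsD card_cnbr; congr (_ - #|pred_of_set _|); apply/setIidPr/subsetP => u.
by rewrite inE => /(universal_cnbr x).
Qed.

Lemma mem_block (x y : G) : (y \in block x) = ~~ universal y && (y \in cnbr x).
Proof. by rewrite inE inE. Qed.

Lemma join_two_cliques (t y : G) :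
  (exists u : G, universal u) -> ~~ universal t -> y \notin cnbr t ->
  degree t <> degree y ->
  (forall x, x \notin cnbr t -> degree x = degree y) ->
  (forall x, x \notin cnbr y -> degree x = degree t) ->
  (forall x z : G, ~~ universal x -> ~~ universal z -> z \in cnbr x ->
     cnbr z = cnbr x) ->
  exists a b c : nat,
      [/\ (1 <= a)%N, (1 <= b)%N, (1 <= c)%N, a <> b
        & isomorphic G
            (graph_join (complete c)
               (disjoint_union (complete a) (complete b)))].
Proof.
move=> [u uU] tU yt dty dt dy blockE.
have yU : ~~ universal y by apply: contra yt => /universal_cnbr.
pose h (x : 'I_#|universals| + ('I_#|block t| + 'I_#|block y|)) : G :=
  match x with
  | inl i => enum_val i
  | inr (inl i) => enum_val i
  | inr (inr i) => enum_val i
  end.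
have univP (i : 'I_#|universals|) : universal (enum_val i).
  by have := enum_valP i; rewrite inE.
have tP (i : 'I_#|block t|) : ~~ universal (enum_val i) /\ cnbr (enum_val i) = cnbr t.
  have := enum_valP i; rewrite mem_block => /andP[iU it].
  by split=> //; apply: blockE.
have yP (i : 'I_#|block y|) : ~~ universal (enum_val i) /\ cnbr (enum_val i) = cnbr y.
  have := enum_valP i; rewrite mem_block => /andP[iU it].
  by split=> //; apply: blockE.
have ut (i : 'I_#|universals|) (j : 'I_#|block t|) :
    (enum_val i == enum_val j) = false.
  by apply: contraNF (tP j).1 => /eqP <-.
have uy (i : 'I_#|universals|) (j : 'I_#|block y|) :
    (enum_val i == enum_val j) = false.
  by apply: contraNF (yP j).1 => /eqP <-.
have non_ty (i : 'I_#|block t|) (j : 'I_#|block y|) :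
    enum_val j \in cnbr (enum_val i) = false.
  rewrite (tP i).2 cnbr_sym (yP j).2.
  by rewrite cnbr_sym; apply: negbTE.
have ty (i : 'I_#|block t|) (j : 'I_#|block y|) :
    (enum_val i == enum_val j) = false.
  by apply: contraFF (non_ty i j) => /eqP <-; apply: cnbr_refl.
exists #|block t|, #|block y|, #|universals|; split.
- by apply/card_gt0P; exists t; rewrite mem_block tU cnbr_refl.
- by apply/card_gt0P; exists y; rewrite mem_block yU cnbr_refl.
- by apply/card_gt0P; exists u; rewrite inE.
(* The subtraction in [card_block] is truncated; this bound lets distinct degrees give distinct
   block sizes. *)
- have sub (x : G) : #|universals| <= (degree x).+1.
    rewrite -card_cnbr; apply/subset_leq_card/subsetP => v.
    by rewrite inE => /universal_cnbr.
  rewrite !card_block; have := sub t; have := sub y; lia.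
apply: (@embedding_isomorphic G
  (graph_join (complete _) (disjoint_union (complete _) (complete _))) h).
- move=> [i|[i|i]] [j|[j|j]] /= /eqP; rewrite ?ut ?uy ?ty // 1?eq_sym ?ut ?uy ?ty //.
  + by move=> /eqP/enum_val_inj->.
  + by move=> /eqP/enum_val_inj->.
  + by move=> /eqP/enum_val_inj->.
- move=> [i|[i|i]] [j|[j|j]] /=; rewrite edge_cnbr /complete_edge.
  + by rewrite (inj_eq enum_val_inj) universal_cnbr ?andbT.
  + by rewrite ut cnbr_sym universal_cnbr.
  + by rewrite uy cnbr_sym universal_cnbr.
  + by rewrite eq_sym ut universal_cnbr.
  + rewrite (inj_eq enum_val_inj) (tP i).2 -(tP j).2 cnbr_refl; exact: andbT.
  + by rewrite non_ty andbF.
  + by rewrite eq_sym uy universal_cnbr.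
  + by rewrite cnbr_sym non_ty andbF.
  + rewrite (inj_eq enum_val_inj) (yP i).2 -(yP j).2 cnbr_refl; exact: andbT.
(* The universal vertices and the two blocks cover [G]: a vertex outside both N[t] and N[y] would
   have degree d(y) and d(t) at once. *)
rewrite !card_sum !card_ord -cardsT.
apply: leq_trans (leq_trans (leq_card_setU universals (block t :|: block y)) _).
  apply/subset_leq_card/subsetP => x _; rewrite !in_setU !mem_block inE.
  case: (universal x) => //=; apply/negPn/negP; rewrite negb_or => /andP[xt xy].
  by apply: dty; rewrite -(dt x) // (dy x).
by rewrite leq_add2l leq_card_setU.
Qed.

Lemma join_equal_cliques (t y : G) :
  (exists u : G, universal u) -> ~~ universal t -> y \notin cnbr t ->
  (forall x : G, ~~ universal x -> degree x = degree t) ->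
  (forall x z : G, ~~ universal x -> ~~ universal z -> z \in cnbr x ->
     cnbr z = cnbr x) ->
  exists t a c : nat,
      [/\ (2 <= t)%N, (1 <= a)%N, (1 <= c)%N
        & isomorphic G (graph_join (complete c) (copies t (complete a)))].
Proof.
move=> [u uU] tU yt dt blockE.
have yU : ~~ universal y by apply: contra yt => /universal_cnbr.
pose P := [set block x | x in [pred x : G | ~~ universal x]].
pose a := (degree t).+1 - #|universals|.
have PP S : S \in P -> #|S| = a.
  by case/imsetP => x xU ->; rewrite card_block dt.
have Pcnbr S (x : G) : S \in P -> x \in S ->
    [/\ ~~ universal x, S = block x & forall z, (z \in cnbr x) = universal z || (z \in S)].
  case/imsetP => x0 x0U ->; rewrite mem_block => /andP[xU xx0].
  have E := blockE _ _ x0U xU xx0; rewrite /block -E; split=> // z.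
  rewrite !inE; case: (boolP (universal z)) => //= zU.
  by rewrite -in_cnbr universal_cnbr.
have Pin (x : G) : ~~ universal x -> block x \in P by move=> xU; apply/imsetP; exists x.
(* Copies are indexed by the blocks and vertices by their position in a block. The default [t] is
   never reached, as every block has size [a]. *)
pose h (x : 'I_#|universals| + 'I_#|P| * 'I_a) : G :=
  match x with
  | inl i => enum_val i
  | inr (i, j) => nth t (enum (enum_val i)) j
  end.
have univP (i : 'I_#|universals|) : universal (enum_val i).
  by have := enum_valP i; rewrite inE.
have size_block (i : 'I_#|P|) : size (enum (enum_val i)) = a.
  by rewrite -cardE PP // enum_valP.
have hP (i : 'I_#|P|) (j : 'I_a) : nth t (enum (enum_val i)) j \in enum_val i.
  by rewrite -mem_enum mem_nth // size_block.
have hU (i : 'I_#|P|) (j : 'I_a) : ~~ universal (nth t (enum (enum_val i)) j).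
  by have [] := Pcnbr _ _ (enum_valP i) (hP i j).
have uh k (i : 'I_#|P|) (j : 'I_a) :
    (enum_val (k : 'I_#|universals|) == nth t (enum (enum_val i)) j) = false.
  by apply: contraNF (hU i j) => /eqP <-.
have same_block (i i' : 'I_#|P|) z : z \in enum_val i -> z \in enum_val i' -> i = i'.
  move=> zi zi'; apply: enum_val_inj.
  by have [_ -> _] := Pcnbr _ _ (enum_valP i) zi; have [_ -> _] := Pcnbr _ _ (enum_valP i') zi'.
have hh (i i' : 'I_#|P|) (j j' : 'I_a) :
    nth t (enum (enum_val i)) j = nth t (enum (enum_val i')) j' -> (i, j) = (i', j').
  move=> E; have ii' : i = i' by apply: (same_block _ _ _ (hP i j)); rewrite E.
  rewrite -ii' in E *; move/eqP: E.
  by rewrite nth_uniq ?enum_uniq ?size_block // => /eqP/val_inj->.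
exists #|P|, a, #|universals|; split.
(* There are at least two blocks, since [y] lies in its own block but not in that of [t]. *)
- have -> : 2 = #|[set block t; block y]|.
    rewrite cards2; case: eqVneq => // E; case/negP: yt.
    have : y \in block y by rewrite mem_block yU cnbr_refl.
    by rewrite -E mem_block => /andP[].
  by apply/subset_leq_card/subsetP => S; rewrite !inE => /orP[]/eqP->; apply: Pin.
- rewrite /a -card_block; apply/card_gt0P; exists t.
  by rewrite mem_block tU cnbr_refl.
- by apply/card_gt0P; exists u; rewrite inE.
apply: (@embedding_isomorphic G (graph_join (complete _) (copies _ (complete _))) h).
- move=> [k|[i j]] [k'|[i' j']] /= E.
  + by rewrite (enum_val_inj E).
  + by move/eqP: E; rewrite uh.
  + by move/eqP: E; rewrite eq_sym uh.
  + by rewrite (hh _ _ _ _ E).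
- move=> [k|[i j]] [k'|[i' j']] /=; rewrite edge_cnbr /complete_edge.
  + by rewrite (inj_eq enum_val_inj) universal_cnbr ?andbT.
  + by rewrite uh cnbr_sym universal_cnbr.
  + by rewrite eq_sym uh universal_cnbr.
  + have [_ _ ->] := Pcnbr _ _ (enum_valP i) (hP i j).
    rewrite (negPf (hU _ _)) /copies_edge /= /complete_edge.
    have [<-|ii'] := eqVneq i i'.
      rewrite hP andbT; congr (~~ _); apply/eqP/eqP => [/hh [] //|-> //].
    rewrite andbC; case: (boolP (_ \in _)) => // /same_block E.
    by rewrite (E _ (hP i' j')) eqxx in ii'.
rewrite card_sum card_prod !card_ord -cardsT -sum_nat_const.
have -> : \sum_(S in P) a = \sum_(S in P) #|S| by apply: eq_bigr => S /PP.
have [le_cover _] := leq_card_cover P.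
apply: leq_trans (leq_trans (leq_card_setU universals (cover P)) _); last by rewrite leq_add2l.
apply/subset_leq_card/subsetP => x _; rewrite in_setU inE.
case: (boolP (universal x)) => //= xU; apply/bigcupP; exists (block x); first exact: Pin.
by rewrite mem_block xU cnbr_refl.
Qed.

End JoinDecomposition.

(** * The two join forms have the required properties *)

Section Converse.
Local Open Scope ring_scope.
Variable R : rcfType.

(* The second condition fails in C_4 and P_4: vertex 1 has the nonadjacent
   neighbours 0 and 2 but is not adjacent to 3. *)
Definition clique_join (G : sgraph) :=
  (exists u : G, universal u) /\
  forall x y z : G, edge x y -> edge y z -> x != z -> edge x z || universal y.

Lemma clique_join_no_induced (G H : sgraph) (a b c d : H) : clique_join G ->
  edge a b -> edge b c -> a != c -> ~~ edge a c -> b != d -> ~~ edge b d ->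
  ~ has_induced H G.
Proof.
move=> [_ Gx] ab bc ac nac bd nbd [f finj fE].
have : f a != f c by rewrite (inj_eq finj).
have fab : edge (f a) (f b) by rewrite fE.
have fbc : edge (f b) (f c) by rewrite fE.
move=> /(Gx _ _ _ fab fbc); rewrite fE (negPf nac) /= => /universalP/(_ (f d)).
by rewrite in_cnbr fE (inj_eq finj) eq_sym (negPf bd) (negPf nbd).
Qed.

Lemma clique_join_quasi_threshold G : clique_join G -> quasi_threshold G.
Proof.
pose v (k : nat) (k4 : (k < 4)%N) : 'I_4 := Ordinal k4.
move=> Gx; split.
  exact: (@clique_join_no_induced G (cycle_graph 4)
    (v 0 isT) (v 1 isT) (v 2 isT) (v 3 isT)).
exact: (@clique_join_no_induced G (path_graph 4)
  (v 0 isT) (v 1 isT) (v 2 isT) (v 3 isT)).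
Qed.

Lemma clique_join_connected G : clique_join G -> is_connected G.
Proof.
case=> -[u /universalP uG] _; split; first by apply/card_gt0P; exists u.
have uc x : connect (@edge G) u x.
  by have := uG x; rewrite in_cnbr => /orP[/eqP->|/connect1].
move=> x y; apply: connect_trans (uc y).
by rewrite (sym_connect_sym (@edge_sym G)).
Qed.

(** As sums of ones, degrees are computed by the same neighbourhood-sum formulas as the sums of
    degrees. *)
Lemma degreeE (G : sgraph) (x : G) : (degree x)%:R = \sum_(y | edge x y) 1 :> R.
Proof. by rewrite sumr_const /degree cardsE. Qed.

Section Transport.
Variables (G H : sgraph) (f : G -> H).
Hypotheses (fbij : bijective f) (fE : forall x y, edge (f x) (f y) = edge x y).

Lemma iso_sum (F : H -> R) x : \sum_(z | edge (f x) z) F z = \sum_(y | edge x y) F (f y).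
Proof.
rewrite (reindex f) /=; last exact: onW_bij.
by apply: eq_bigl => y; rewrite fE.
Qed.

Lemma iso_degree x : degree (f x) = degree x.
Proof. by apply/eqP; rewrite -(eqr_nat R) !degreeE iso_sum. Qed.

Lemma iso_universal x : universal (f x) = universal x.
Proof.
have finj := bij_inj fbij; have [g fK gK] := fbij.
apply/universalP/universalP => xG y.
  by have := xG (f y); rewrite !in_cnbr fE (inj_eq finj).
by have := xG (g y); rewrite !in_cnbr -fE -(inj_eq finj) gK.
Qed.

Lemma iso_clique_join : clique_join H -> clique_join G.
Proof.
have finj := bij_inj fbij; have [g fK gK] := fbij.
case=> -[u uU] Hx; split; first by exists (g u); rewrite -iso_universal gK.
move=> x y z xy yz xz; rewrite -fE -iso_universal.
by apply: Hx; rewrite ?fE ?(inj_eq finj).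
Qed.

Lemma iso_regular : regular G -> regular H.
Proof.
have [g fK gK] := fbij; case=> k dk; exists k => x.
by rewrite -(gK x) iso_degree.
Qed.

Lemma iso_affine_degree_sums : affine_degree_sums R H -> affine_degree_sums R G.
Proof.
case=> p [q pq]; exists p, q => x; have := pq (f x).
by rewrite iso_sum iso_degree; under eq_bigr do rewrite iso_degree.
Qed.

End Transport.

Lemma isomorphic_two_main (G H : sgraph) : isomorphic G H -> clique_join H ->
  ~ regular H -> affine_degree_sums R H ->
  is_connected G /\ quasi_threshold G /\ num_main_eigenvalues R G 2.
Proof.
case=> f fbij fE Hx Hr Ha; have Gx := iso_clique_join fbij fE Hx.
split; first exact: clique_join_connected.
split; first exact: clique_join_quasi_threshold.
apply/two_main_eigenvalues; split; last exact: iso_affine_degree_sums fbij fE Ha.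
by move=> /(iso_regular fbij fE)/Hr.
Qed.

Lemma sum_complete_all n (k : R) : \sum_(j : complete n) k = n%:R * k.
Proof. by rewrite sumr_const card_ord mulr_natl. Qed.

Lemma sum_complete n (i : complete n) (k : R) :
  \sum_(j | edge i j) k = n%:R * k - k.
Proof.
rewrite -sum_complete_all [in RHS](bigD1 i) //= addrAC subrr add0r.
by apply: eq_bigl => j; rewrite /complete_edge eq_sym.
Qed.

Lemma sum_join_inl (G H : sgraph) (u : G) (F : graph_join G H -> R) :
  \sum_(z | edge (inl u : graph_join G H) z) F z =
  \sum_(v | edge u v) F (inl v) + \sum_(w : H) F (inr w).
Proof. by rewrite big_sumType. Qed.

Lemma sum_join_inr (G H : sgraph) (w : H) (F : graph_join G H -> R) :
  \sum_(z | edge (inr w : graph_join G H) z) F z =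
  \sum_(v : G) F (inl v) + \sum_(z | edge w z) F (inr z).
Proof. by rewrite big_sumType. Qed.

Lemma sum_union_inl (G H : sgraph) (u : G) (F : disjoint_union G H -> R) :
  \sum_(z | edge (inl u : disjoint_union G H) z) F z =
  \sum_(v | edge u v) F (inl v).
Proof. by rewrite big_sumType /= big_pred0_eq addr0. Qed.

Lemma sum_union_inr (G H : sgraph) (w : H) (F : disjoint_union G H -> R) :
  \sum_(z | edge (inr w : disjoint_union G H) z) F z =
  \sum_(v | edge w v) F (inr v).
Proof. by rewrite big_sumType /= big_pred0_eq add0r. Qed.

Lemma sum_copies t (G : sgraph) i (x : G) (F : copies t G -> R) :
  \sum_(z | edge ((i, x) : copies t G) z) F z = \sum_(y | edge x y) F (i, y).
Proof.
transitivity (\sum_(j | j == i) \sum_(y | edge x y) F (j, y)); last first.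
  by rewrite big_pred1_eq.
rewrite pair_big /=; apply: eq_big => [[j y]|[j y] _] //=.
by rewrite /copies_edge eq_sym.
Qed.

Lemma universal_inl n (H : sgraph) (i : complete n) :
  universal (inl i : graph_join (complete n) H).
Proof.
apply/universalP => -[j|j]; rewrite in_cnbr ?orbT //.
by case: (eqVneq i j) => [->|ij]; rewrite ?eqxx //= /complete_edge ij orbT.
Qed.

Lemma two_cliques_two_main (a b c : nat) (G : sgraph) :
  (0 < a)%N -> (0 < b)%N -> (0 < c)%N ->
  isomorphic G (graph_join (complete c) (disjoint_union (complete a) (complete b))) ->
  is_connected G /\ quasi_threshold G /\ num_main_eigenvalues R G 2.
Proof.
move=> a0 b0 c0 iso; apply: (isomorphic_two_main iso).
- split.
    by exists (inl (Ordinal c0)); apply: universal_inl.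
  move=> x [k|y] z xy yz xz.
    by rewrite universal_inl orbT.
  by case: x y z xy yz xz => [i|[i|i]] [j|j] [k|[k|k]] //= _ _ xz;
    apply/orP; left; apply: contraNneq xz => ->.
(* A vertex of [complete c] has degree larger by [b] than one of [complete a]. *)
- case=> k dk.
  have := dk (inl (Ordinal c0)); rewrite -(dk (inr (inl (Ordinal a0)))).
  move=> /(congr1 (fun m => m%:R : R)); rewrite !degreeE.
  rewrite sum_join_inl sum_join_inr sum_union_inl !sum_complete sum_complete_all.
  rewrite big_sumType /= !sum_complete_all !mulr1 => E.
  have /eqP : b%:R = 0 :> R by lra.
  by rewrite pnatr_eq0 eqn0Ngt b0.
pose N : R := c%:R + a%:R + b%:R - 1.
pose da : R := c%:R + a%:R - 1; pose db : R := c%:R + b%:R - 1.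
pose D (x : graph_join (complete c) (disjoint_union (complete a) (complete b))) :=
  match x with inl _ => N | inr (inl _) => da | inr (inr _) => db end.
have DE x : (degree x)%:R = D x.
  rewrite degreeE; case: x => [i|[i|i]].
  - rewrite sum_join_inl sum_complete big_sumType !sum_complete_all /= /N; ring.
  - rewrite sum_join_inr sum_union_inl sum_complete sum_complete_all /= /da; ring.
  - rewrite sum_join_inr sum_union_inr sum_complete sum_complete_all /= /db; ring.
(* Here K = da + db, and p = K + N - 1 since K = p + 1 - d(u); [q] is then read off the equation at
   a universal vertex. *)
exists (da + db + N - 1).
exists (N ^+ 2 + (c%:R - 1) * N + a%:R * da + b%:R * db - (da + db + N - 1) * N).
move=> x; rewrite DE; under eq_bigr do rewrite DE.
case: x => [i|[i|i]].
- rewrite sum_join_inl sum_complete big_sumType !sum_complete_all.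
  by rewrite /= /N /da /db; ring.
- rewrite sum_join_inr sum_union_inl sum_complete sum_complete_all.
  by rewrite /= /N /da /db; ring.
- rewrite sum_join_inr sum_union_inr sum_complete sum_complete_all.
  by rewrite /= /N /da /db; ring.
Qed.

Lemma equal_cliques_two_main (t a c : nat) (G : sgraph) :
  (1 < t)%N -> (0 < a)%N -> (0 < c)%N ->
  isomorphic G (graph_join (complete c) (copies t (complete a))) ->
  is_connected G /\ quasi_threshold G /\ num_main_eigenvalues R G 2.
Proof.
move=> t1 a0 c0 iso; apply: (isomorphic_two_main iso).
- split.
    by exists (inl (Ordinal c0)); apply: universal_inl.
  move=> x [k|y] z xy yz xz.
    by rewrite universal_inl orbT.
  case: x z xy yz xz => [i|[i i']] [k|[k k']] //=.
    by move=> _ _ xz; apply/orP; left; apply: contraNneq xz => ->.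
  case: y => j j'; rewrite /copies_edge /= /complete_edge => /andP[/eqP-> _] /andP[/eqP-> _] xz.
  by rewrite eqxx /=; apply/orP; left; apply: contraNneq xz => ->.
(* The degree drops by (t - 1) a from a universal vertex to one in a copy. *)
- case=> k dk.
  have := dk (inl (Ordinal c0)); rewrite -(dk (inr (Ordinal (ltnW t1), Ordinal a0))).
  move=> /(congr1 (fun m => m%:R : R)); rewrite !degreeE.
  rewrite sum_join_inl sum_join_inr sum_copies !sum_complete sum_complete_all.
  rewrite sumr_const card_prod !card_ord natrM !mulr1 => E.
  have /eqP : (t%:R - 1) * a%:R = 0 :> R by lra.
  by rewrite mulf_eq0 subr_eq0 pnatr_eq1 gtn_eqF // pnatr_eq0 eqn0Ngt a0.
pose N : R := c%:R + t%:R * a%:R - 1; pose d : R := c%:R + a%:R - 1.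
pose D (x : graph_join (complete c) (copies t (complete a))) :=
  match x with inl _ => N | inr _ => d end.
have sum_all k : \sum_(j : copies t (complete a)) k = t%:R * a%:R * k :> R.
  by rewrite sumr_const card_prod !card_ord -natrM mulr_natl.
have DE x : (degree x)%:R = D x.
  rewrite degreeE; case: x => [i|[i j]].
  - rewrite sum_join_inl sum_complete sum_all /= /N; ring.
  - rewrite sum_join_inr sum_copies sum_complete sum_complete_all /= /d; ring.
(* The same constants as for two cliques, now with K = 2 d. *)
exists (d + d + N - 1).
exists (N ^+ 2 + (c%:R - 1) * N + t%:R * a%:R * d - (d + d + N - 1) * N).
move=> x; rewrite DE; under eq_bigr do rewrite DE.
case: x => [i|[i j]].
- by rewrite sum_join_inl sum_complete sum_all /= /N /d; ring.
- by rewrite sum_join_inr sum_copies sum_complete sum_complete_all /= /N /d; ring.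
Qed.

End Converse.

(** * The characterization: the extremal pair forces disjoint cliques *)

Theorem theorem4 (R : rcfType) (G : sgraph) :
  (is_connected G /\ quasi_threshold G /\ num_main_eigenvalues R G 2)
  <->
  ((exists a b c : nat,
      [/\ (1 <= a)%N, (1 <= b)%N, (1 <= c)%N, a <> b
        & isomorphic G
            (graph_join (complete c)
               (disjoint_union (complete a) (complete b)))])
   \/
   (exists t a c : nat,
      [/\ (2 <= t)%N, (1 <= a)%N, (1 <= c)%N
        & isomorphic G (graph_join (complete c) (copies t (complete a)))])).
Proof.
split; last first.
  case=> [[a [b [c [a0 b0 c0 _ iso]]]]|[t [a [c [t2 a0 c0 iso]]]]].
    exact: two_cliques_two_main iso.
  exact: equal_cliques_two_main iso.
move=> [conn [/quasi_threshold_nested nest /two_main_eigenvalues[nreg aff]]].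
have exU := universal_exists conn nest.
have [t [y [tU yt tmax dt dy]]] := extremal_pair nest exU nreg aff.
have in_t (x z : G) : ~~ universal x -> x \in cnbr t -> z \in cnbr x -> z \in cnbr t.
  by move=> xU xt; apply/subsetP/nest => //; apply: tmax.
(* By [in_t], adjacent nonuniversal vertices lie both inside or both outside N[t]. Outside, the
   degree is d(y); inside, they avoid N[y], as otherwise [y] would be in N[t], so the degree is
   d(t). *)
have same_degree (x z : G) : ~~ universal x -> ~~ universal z -> z \in cnbr x ->
    degree z = degree x.
  move=> xU zU zx; have xz : x \in cnbr z by rewrite cnbr_sym.
  have [xt|xt] := boolP (x \in cnbr t); last first.
    rewrite (dt x) // dt //; apply: contra xt => zt; exact: in_t xz.
  have nbr_y w : ~~ universal w -> w \in cnbr t -> w \notin cnbr y.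
    by move=> wU wt; apply: contra yt; rewrite cnbr_sym; apply: in_t.
  by rewrite !dy // nbr_y // (in_t x).
(* With equal degrees, nestedness applies in both directions. *)
have blockE (x z : G) : ~~ universal x -> ~~ universal z -> z \in cnbr x ->
    cnbr z = cnbr x.
  move=> xU zU zx; have dzx := same_degree x z xU zU zx.
  apply/eqP; rewrite eqEsubset !nest ?dzx //.
  by rewrite cnbr_sym.
have [dty|dty] := eqVneq (degree t) (degree y).
  right; apply: (join_equal_cliques exU tU yt) => // x xU.
  have [xt|/dt ->//] := boolP (x \in cnbr t).
  exact: same_degree xt.
left; apply: (join_two_cliques exU tU yt) => //; exact/eqP.
Qed.
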